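(* Let $X$ be a finite weighted simplicial complex with positive weights, let $D=d_{\max}(X)\ge 1$, and let $f\colon\mathbb{R}\to\mathbb{R}$ satisfy $f(0)=0$ and $f'(0)>0$. Let $F\colon\mathbb{R}\to\mathbb{R}$ be any antiderivative of $f$. For $0\le d\le D$ and $\omega_d\in C_d(X)$, define $$E_{d,1}(\theta_d)=\sum_{i\in X_{d+1}}\big(W_{d+1}F(B_{d+1}^{\intercal}\theta_d)\big)_i\quad(d<D),\qquad E_{d,2}(\theta_d)=\sum_{i\in X_{d-1}}F(B_dW_d\theta_d)_i\quad(d>0),$$ and $$E_d(\theta_d)=-\langle\omega_d,W_d\theta_d\rangle+E_{d,1}(\theta_d)+E_{d,2}(\theta_d),$$ where for $d=0$ the undefined term $E_{d,2}$ is omitted and for $d=D$ the undefined term $E_{d,1}$ is omitted. Then the $d$-simplex flow on $X$ is the flow $$\frac{d}{dt}\theta_d=-W_d^{-1}\nabla E_d(\theta_d).$$ In particular, the flow is a (rescaled) downhill gradient flow.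
   Context: Let $X$ be a finite simplicial complex (a finite collection of nonempty finite sets, called simplices, closed under taking faces). $X_d$ is the set of simplices of dimension $d$ (with $d+1$ vertices), and $d_{\max}(X)$ is the maximal dimension of a simplex. Each simplex is given an orientation, and each simplex $S$ carries a weight $w(S)>0$. $C_d(X)$ is the real vector space with basis $X_d$, identified with $\mathbb{R}^{|X_d|}$ via this basis; $\langle\cdot,\cdot\rangle$ is the standard inner product and $\nabla$ the standard gradient in these coordinates. $B_d$ is the matrix of the boundary map $\partial_d\colon C_d(X)\to C_{d-1}(X)$, $[v_0,\dots,v_d]\mapsto\sum_{\ell=0}^d(-1)^\ell[v_0,\dots,\widehat{v_\ell},\dots,v_d]$ ($d\ge1$), and $W_d$ is the diagonal matrix of the weights of the $d$-simplices. Scalar functions are applied to vectors componentwise. Given $f\colon\mathbb{R}\to\mathbb{R}$ and $\omega_d\in C_d(X)$, and with $D=d_{\max}(X)$, the $d$-simplex flow is the system $$\frac{d}{dt}\theta_d=\omega_d-\left[W_d^{-1}B_{d+1}W_{d+1}f(B_{d+1}^{\intercal}\theta_d)+B_d^{\intercal}W_{d-1}^{-1}f(B_dW_d\theta_d)\right],\qquad \theta_d\in C_d(X),$$ where for $d=0$ the second term in the bracket is dropped and for $d=D$ the first term in the bracket is dropped.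
   Formalization: The printed E_{d,2} omits a weight factor and the claim fails for (d−1)-simplices of non-unit weight; the formal statement uses E_{d,2}(θ_d)=Σ_{i∈X_{d−1}}(W_{d−1}^{-1}F(B_dW_dθ_d))_i, which agrees with the printed one when W_{d−1}=I. *)

(* Defs.v *)
From HB Require Import structures.
From mathcomp Require Import all_boot all_order all_algebra perm.
From mathcomp Require Import reals topology normedtype derive.

Set Implicit Arguments.
Unset Strict Implicit.
Unset Printing Implicit Defensive.

Import Order.TTheory GRing.Theory Num.Theory.
Import numFieldNormedType.Exports.

Local Open Scope ring_scope.

(* The values of [orientation] and [weight] outside [simplices] are never used. *)
Record weighted_complex (R : realType) (V : finType) := WeightedComplex {
  simplices : {set {set V}};
  simplex_neq0 : forall S, S \in simplices -> S != set0;
  face_closed : forall S T : {set V},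
    S \in simplices -> T \subset S -> T != set0 -> T \in simplices;
  (* an ordering of the vertices, standing for its class modulo even
     permutations *)
  orientation : {set V} -> seq V;
  orientation_uniq : forall S, S \in simplices -> uniq (orientation S);
  orientation_mem : forall S, S \in simplices -> orientation S =i S;
  weight : {set V} -> R;
  weight_gt0 : forall S, S \in simplices -> 0 < weight S
}.

Definition simplices_dim (R : realType) (V : finType)
    (X : weighted_complex R V) (d : nat) : {set {set V}} :=
  [set S in simplices X | #|S| == d.+1].

Definition dmax (R : realType) (V : finType) (X : weighted_complex R V) : nat :=
  \max_(S in simplices X) #|S|.-1.

Definition nb_simplices (R : realType) (V : finType)
    (X : weighted_complex R V) (d : nat) : nat := #|simplices_dim X d|.

Definition simplex (R : realType) (V : finType) (X : weighted_complex R V)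
    (d : nat) (i : 'I_(nb_simplices X d)) : {set V} := enum_val i.

Definition chain (R : realType) (V : finType) (X : weighted_complex R V)
    (d : nat) : Type := 'cV[R]_(nb_simplices X d).

(* The coefficient of [s] on the basis simplex oriented by [t] (duplicate-free):
   the signature of the permutation taking [t] to [s], and 0 if [s] and [t] do
   not span the same simplex. *)
Definition orientation_sign (R : realType) (V : finType) (s t : seq V) : R :=
  if [pick p : 'S_(size t) |
       s == [seq tnth (in_tuple t) (p i) | i : 'I_(size t)]] is Some p
  then (-1) ^+ odd_perm p else 0.

Definition delete_nth (T : Type) (l : nat) (s : seq T) : seq T :=
  take l s ++ drop l.+1 s.

(* [boundary_mx X d] is B_(d+1), the matrix of C_(d+1)(X) -> C_d(X). *)
Definition boundary_mx (R : realType) (V : finType) (X : weighted_complex R V)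
    (d : nat) : 'M[R]_(nb_simplices X d, nb_simplices X d.+1) :=
  \matrix_(i, j) \sum_(l < d.+2)
    (-1) ^+ l * orientation_sign R (delete_nth l (orientation X (simplex j)))
                                   (orientation X (simplex i)).

Definition weight_mx (R : realType) (V : finType) (X : weighted_complex R V)
    (d : nat) : 'M[R]_(nb_simplices X d) :=
  diag_mx (\row_i weight X (simplex i)).

Definition upper_coupling (R : realType) (V : finType)
    (X : weighted_complex R V) (f : R -> R) (d : nat) (theta : chain X d) :
    chain X d :=
  if (d < dmax X)%N then
    invmx (weight_mx X d) *m boundary_mx X d *m weight_mx X d.+1
      *m map_mx f ((boundary_mx X d)^T *m theta)
  else 0.

Definition lower_coupling (R : realType) (V : finType)
    (X : weighted_complex R V) (f : R -> R) (d : nat) : chain X d -> chain X d :=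
  match d return chain X d -> chain X d with
  | 0 => fun=> 0
  | k.+1 => fun theta =>
      (boundary_mx X k)^T *m invmx (weight_mx X k)
        *m map_mx f (boundary_mx X k *m weight_mx X k.+1 *m theta)
  end.

(* The flow is an autonomous system, represented by its right-hand side. *)
Definition simplex_flow (R : realType) (V : finType) (X : weighted_complex R V)
    (f : R -> R) (d : nat) (omega : chain X d) (theta : chain X d) : chain X d :=
  omega - (upper_coupling f theta + lower_coupling f theta).

Definition inner (R : realType) (n : nat) (u v : 'cV[R]_n) : R :=
  \sum_i u i 0 * v i 0.

Definition upper_energy (R : realType) (V : finType) (X : weighted_complex R V)
    (F : R -> R) (d : nat) (theta : chain X d) : R :=
  if (d < dmax X)%N then
    \sum_i (weight_mx X d.+1 *m map_mx F ((boundary_mx X d)^T *m theta)) i 0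
  else 0.

(* The factor [invmx (weight_mx X k)] is forced by the one in [lower_coupling]:
   without it the gradient of this term is not the lower coupling unless the
   weights in dimension k are 1. *)
Definition lower_energy (R : realType) (V : finType) (X : weighted_complex R V)
    (F : R -> R) (d : nat) : chain X d -> R :=
  match d return chain X d -> R with
  | 0 => fun=> 0
  | k.+1 => fun theta =>
      \sum_i (invmx (weight_mx X k)
        *m map_mx F (boundary_mx X k *m weight_mx X k.+1 *m theta)) i 0
  end.

Definition energy (R : realType) (V : finType) (X : weighted_complex R V)
    (F : R -> R) (d : nat) (omega : chain X d) (theta : chain X d) : R :=
  - inner omega (weight_mx X d *m theta)
  + upper_energy F theta + lower_energy F theta.

(* Partial derivatives are total here, so statements about [gradient] come with
   the differentiability of the function. *)
Definition gradient (R : realType) (n : nat) (E : 'cV[R]_n -> R)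
    (theta : 'cV[R]_n) : 'cV[R]_n :=
  \col_i 'D_(delta_mx i 0) E theta.

Definition rescaled_downhill_gradient_flow (R : realType) (n : nat)
    (E : 'cV[R]_n -> R) (v : 'cV[R]_n -> 'cV[R]_n) : Prop :=
  exists2 p : 'rV[R]_n, (forall i, 0 < p 0 i) &
    forall theta, differentiable E theta /\
      v theta = - (diag_mx p *m gradient E theta).

(* Main.v *)
Require Import Defs.
From HB Require Import structures.
From mathcomp Require Import all_boot all_order all_algebra.
From mathcomp Require Import boolp functions reals topology normedtype derive.

Import Order.TTheory GRing.Theory Num.Theory.
Import numFieldNormedType.Exports.
Local Open Scope ring_scope.

(* Each summand of the energy is linear or has the form [sum_i r_i F((A theta)_i)]
   with r constant. By the chain rule the latter has gradient
   [A^T diag(r) f(A theta)], and [W_d^-1] turns the gradients into the three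
   terms of the flow because the weight matrices are diagonal and invertible. *)

Lemma innerE (R : realType) (n : nat) (u v : 'cV[R]_n) :
  inner u v = (u^T *m v) 0 0.
Proof. by rewrite /inner mxE; apply: eq_bigr => i _; rewrite mxE. Qed.

(** The codomain [R^o] is [R] as a module over itself; registering this linearity lets [inner u]
    serve as its own differential. *)
Lemma inner_is_linear (R : realType) (n : nat) (u : 'cV[R]_n) :
  linear (inner u : 'cV[R]_n -> R^o).
Proof. by move=> a x y; rewrite !innerE linearP /= !mxE. Qed.

HB.instance Definition _ (R : realType) (n : nat) (u : 'cV[R]_n) :=
  GRing.isLinear.Build R 'cV[R]_n R^o *:%R (inner u) (@inner_is_linear R n u).

Lemma innerDl (R : realType) (n : nat) (u v w : 'cV[R]_n) :
  inner (u + v) w = inner u w + inner v w.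
Proof. by rewrite !innerE linearD mulmxDl mxE. Qed.

Lemma inner_delta_mx (R : realType) (n : nat) (u : 'cV[R]_n) (i : 'I_n) :
  inner u (delta_mx i 0) = u i 0.
Proof. by rewrite innerE -colE !mxE. Qed.

Lemma is_diff_sum (R : realType) (V W : normedModType R) (n : nat)
    (g dg : 'I_n -> V -> W) (x : V) :
  (forall i, is_diff x (g i) (dg i)) ->
  is_diff x (\sum_i g i) (\sum_i dg i).
Proof.
move=> dgx; elim/big_ind2: _ => //; first exact: is_diff_cst.
by move=> *; apply: is_diffD.
Qed.

Lemma is_diff_inner (R : realType) (n : nat) (u x : 'cV[R]_n) :
  is_diff x (inner u : 'cV[R]_n -> R) (inner u).
Proof.
(* A continuous linear map is its own differential. Continuity comes from differentiability, which
   holds for a finite combination of coordinate functions. *)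
have dinner (y : 'cV[R]_n) : differentiable (inner u : 'cV[R]_n -> R) y.
  rewrite (_ : inner u = \sum_i u i 0 *: (fun z : 'cV[R]_n => z i 0)); last first.
    by apply/funext => z; rewrite fct_sumE.
  by apply: differentiable_sum => i; apply/differentiableZ/differentiable_coord.
apply: DiffDef; first exact: dinner.
apply: (@diff_lin _ _ R^o (inner u)) => y.
exact/differentiable_continuous/dinner.
Qed.

(** Partial derivatives are values of the differential on the standard basis, and [inner g] returns
    there the entries of [g]. *)
Lemma gradient_is_diff (R : realType) (n : nat) (E : 'cV[R]_n -> R)
    (x g : 'cV[R]_n) :
  is_diff x E (inner g) -> gradient E x = g.
Proof.
move=> dE; apply/colP => i; rewrite mxE deriveE ?diff_val //.
exact: inner_delta_mx.
Qed.

Lemma is_diff_derive (R : realType) (F : R -> R) (x y : R) :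
  is_derive x 1 F y -> is_diff x F (fun h => h * y).
Proof.
move=> dF; have dFx : differentiable F x by exact/derivable1_diffP.
apply: DiffDef => //; rewrite diff1E //; apply/funext => h.
by rewrite derive1E derive_val.
Qed.

(** Serves both coupling energies: [A] is the transposed boundary matrix for the upper one, and
    boundary times weights for the lower one. *)
Lemma is_diff_weighted_potential (R : realType) (m n : nat) (r : 'rV[R]_m)
    (A : 'M[R]_(m, n)) (f F : R -> R) (x : 'cV[R]_n) :
  (forall y : R, is_derive y 1 F (f y)) ->
  is_diff x (fun z => \sum_i (diag_mx r *m map_mx F (A *m z)) i 0)
            (inner (A^T *m diag_mx r *m map_mx f (A *m x))).
Proof.
move=> dF; have AE i z : (A *m z) i 0 = inner (row i A)^T z.
  by rewrite innerE trmxK -row_mul [RHS]mxE.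
(* Each summand becomes [F] after the linear form given by row [i] of [A], so the one-variable chain
   rule applies. *)
rewrite (_ : (fun z => _) =
    \sum_i r 0 i *: (F \o (inner (row i A)^T : 'cV[R]_n -> R))); last first.
  apply/funext => z; rewrite fct_sumE; apply: eq_bigr => i _.
  by rewrite mul_diag_mx [LHS]mxE [X in _ * X = _]mxE AE.
have dsummand i : is_diff x (r 0 i *: (F \o (inner (row i A)^T : 'cV[R]_n -> R)))
    (r 0 i *: ((fun h => h * f (inner (row i A)^T x)) \o inner (row i A)^T)).
  apply/is_diffZ/is_diff_comp; first exact: is_diff_inner.
  exact: (is_diff_derive _ _ _ _ (dF _)).
apply: (is_diff_eq (is_diff_sum _ _ _ _ _ _ _ dsummand)).
(* Both sides expand to the sum over [i] of [r_i f((A x)_i) (A h)_i]. *)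
apply/funext => h; rewrite fct_sumE innerE !trmx_mul trmxK tr_diag_mx.
rewrite -!mulmxA mxE; apply: eq_bigr => i _.
rewrite mul_diag_mx [X in _ = X * _]mxE [X in _ = X * _]mxE.
by rewrite [X in _ = _ * X]mxE !AE [RHS]mulrCA [X in _ = _ * X]mulrC.
Qed.

Section Weights.
Variables (R : realType) (V : finType) (X : weighted_complex R V).

Lemma weight_simplex_gt0 (d : nat) (i : 'I_(nb_simplices X d)) :
  0 < weight X (simplex i).
Proof. by apply: weight_gt0; have := enum_valP i; rewrite inE => /andP[]. Qed.

Lemma weight_mx_unit (d : nat) : weight_mx X d \in unitmx.
Proof.
rewrite unitmxE det_diag unitfE; apply/prodf_neq0 => i _.
by rewrite mxE lt0r_neq0 ?weight_simplex_gt0.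
Qed.

(** The diagonal form provides the row [r] for the lower energy and the positive rescaling factors
    of the gradient flow. *)
Lemma invmx_weight_mx (d : nat) :
  invmx (weight_mx X d) = diag_mx (\row_i (weight X (simplex i))^-1).
Proof.
rewrite -[RHS](mulKmx (weight_mx_unit d)) mulmx_diag.
rewrite (_ : (\row_j _) = const_mx 1) ?diag_const_mx ?mulmx1 //.
by apply/rowP => i; rewrite !mxE divff ?lt0r_neq0 ?weight_simplex_gt0.
Qed.

Lemma tr_weight_mx (d : nat) : (weight_mx X d)^T = weight_mx X d.
Proof. exact: tr_diag_mx. Qed.

Context (f F : R -> R) (hF : forall x : R, is_derive x 1 F (f x)).

(** The symmetry of [weight_mx X d] moves it onto [omega]. The factor is kept in front, as for the
    two couplings, so that the three gradients add up to the weight matrix times minus the flow. *)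
Lemma is_diff_linear_energy (d : nat) (omega theta : chain X d) :
  is_diff theta (fun z : chain X d => - inner omega (weight_mx X d *m z))
                (inner (weight_mx X d *m - omega)).
Proof.
rewrite (_ : (fun z => _) = inner (weight_mx X d *m - omega)).
  exact: is_diff_inner.
apply/funext => z.
by rewrite !innerE trmx_mul tr_weight_mx (linearN trmx) /= !mulNmx mulmxA [RHS]mxE.
Qed.

Lemma is_diff_upper_energy (d : nat) (theta : chain X d) :
  is_diff theta (@upper_energy _ _ X F d)
                (inner (weight_mx X d *m upper_coupling f theta)).
Proof.
rewrite /upper_energy /upper_coupling; case: ifP => _; last first.
  rewrite mulmx0 (_ : inner 0 = 0); first exact: is_diff_cst.
  by apply/funext => z; rewrite innerE linear0 mul0mx mxE.
rewrite -!mulmxA (mulKVmx (weight_mx_unit d)) mulmxA.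
(* The outer weights have cancelled; a double transpose shows the pattern [A^T diag(r) f(A theta)]
   with [A = (boundary_mx X d)^T]. *)
rewrite -[X in X *m weight_mx _ _]trmxK.
exact: is_diff_weighted_potential.
Qed.

Lemma is_diff_lower_energy (d : nat) (theta : chain X d) :
  is_diff theta (@lower_energy _ _ X F d)
                (inner (weight_mx X d *m lower_coupling f theta)).
Proof.
case: d theta => [|k] theta /=.
  rewrite mulmx0 (_ : inner 0 = 0); first exact: is_diff_cst.
  by apply/funext => z; rewrite innerE linear0 mul0mx mxE.
(* By symmetry [W B^T = (B W)^T], so the pattern appears with [A = B W] and [r] the inverse weights
   one dimension below. *)
rewrite 2!mulmxA -[X in X *m _ *m _ *m _]tr_weight_mx -trmx_mul invmx_weight_mx.
exact: is_diff_weighted_potential.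
Qed.

Lemma is_diff_energy (d : nat) (omega theta : chain X d) :
  is_diff theta (energy F omega)
    (inner (weight_mx X d *m - simplex_flow f omega theta)).
Proof.
have dE := is_diffD (is_diffD (is_diff_linear_energy d omega theta)
  (is_diff_upper_energy d theta)) (is_diff_lower_energy d theta).
apply: (is_diff_eq dE).
apply/funext => z.
by rewrite /simplex_flow opprD opprK addrA !mulmxDr !innerDl.
Qed.

End Weights.

Theorem proposition3p2 (R : realType) (V : finType) (X : weighted_complex R V)
    (hD : (1 <= dmax X)%N)
    (f : R -> R) (hf0 : f 0 = 0)
    (hf_derivable : derivable f 0 1) (hf'0 : 0 < derive1 f 0)
    (F : R -> R) (hF : forall x : R, is_derive x 1 F (f x))
    (d : nat) (hd : (d <= dmax X)%N) (omega : chain X d) :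
  (forall theta : chain X d,
     differentiable (energy F omega) theta /\
     simplex_flow f omega theta
       = - (invmx (weight_mx X d) *m gradient (energy F omega) theta)) /\
  rescaled_downhill_gradient_flow (energy F omega) (simplex_flow f omega).
Proof.
have flowE (theta : chain X d) : differentiable (energy F omega) theta /\
    simplex_flow f omega theta
      = - (invmx (weight_mx X d) *m gradient (energy F omega) theta).
  have dE := is_diff_energy _ _ X _ _ hF _ omega theta.
  split; first exact: ex_diff.
  by rewrite (gradient_is_diff _ _ _ _ _ dE) mulKmx ?weight_mx_unit ?opprK.
(* The rescaling is the diagonal of the inverse weight matrix. *)
split=> //; exists (\row_i (weight X (simplex i))^-1).
  by move=> i; rewrite mxE invr_gt0 weight_simplex_gt0.
by move=> theta; rewrite -invmx_weight_mx; exact: flowE.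
Qed.
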